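(* Let $\alpha,\beta>-1$ be real numbers and let $n\ge 0$ be an integer. For every $i=0,1,\ldots,n$, the following identity of polynomials in $x$ holds: $$(x-1)(i+1)\,D^n_i(x;\alpha,\beta)+x(n-i)\,D^n_{i+1}(x;\alpha,\beta)=\frac{-C^{(\alpha,\beta)}_{n,i+1}}{2n+\sigma+2}\,T^{(\alpha,\beta)}_{ni}(x),$$ where $\sigma:=\alpha+\beta+1$, $D^n_i(\cdot;\alpha,\beta)$ are the dual Bernstein polynomials of degree $n$ (with $D^n_{n+1}:=0$), $$C^{(\alpha,\beta)}_{nk}:=(-1)^{n-k+1}\frac{(2n+\sigma+2)(\sigma+1)_n}{K(\alpha+1)_{n-k+1}(\beta+1)_k},\qquad K:=\frac{\Gamma(\alpha+1)\Gamma(\beta+1)}{\Gamma(\sigma+1)},$$ and $$T^{(\alpha,\beta)}_{ni}(x):=(n-i)(n+\alpha+1)\,x\,R^{(\alpha,\beta+1)}_n(x)+(i+1)(n+\beta+1)(1-x)\,R^{(\alpha+1,\beta)}_n(x),$$ with $R^{(a,b)}_n$ the shifted Jacobi polynomials.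
   Context: Pochhammer symbol: $(c)_0:=1$, $(c)_l:=c(c+1)\cdots(c+l-1)$ for $l\ge1$. Shifted Jacobi polynomials, for $a,b>-1$: $$R_n^{(a,b)}(x):=\frac{(a+1)_n}{n!}\sum_{k=0}^{n}\frac{(-n)_k(n+a+b+1)_k}{k!\,(a+1)_k}(1-x)^k.$$ Inner product: $\langle f,g\rangle_{\alpha,\beta}:=\int_0^1(1-x)^\alpha x^\beta f(x)g(x)\,dx$, with $\alpha,\beta>-1$. Bernstein basis polynomials: $B^n_i(x):=\binom{n}{i}x^i(1-x)^{n-i}$, $0\le i\le n$. Dual Bernstein polynomials of degree $n$: the unique polynomials $D^n_0(x;\alpha,\beta),\ldots,D^n_n(x;\alpha,\beta)$ of degree at most $n$ such that $\langle B^n_i,D^n_j(\cdot;\alpha,\beta)\rangle_{\alpha,\beta}=\delta_{ij}$ for $i,j=0,1,\ldots,n$. By convention, $D^n_i(x;\alpha,\beta):=0$ for $i<0$ or $i>n$. *)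

(* Defs.v *)
From mathcomp Require Import all_boot all_order all_algebra.
From mathcomp Require Import all_classical all_reals all_analysis.

Set Implicit Arguments.
Unset Strict Implicit.
Unset Printing Implicit Defensive.

Import Order.TTheory GRing.Theory Num.Theory.
Import numFieldNormedType.Exports.

Local Open Scope classical_set_scope.
Local Open Scope ring_scope.

Definition pochhammer (R : realType) (c : R) (l : nat) : R :=
  \prod_(j < l) (c + j%:R).

(* Euler's integral; it is the Gamma function for z > 0 only. *)
Definition Gamma (R : realType) (z : R) : R :=
  \int[@lebesgue_measure R]_(t in `]0, +oo[) (t `^ (z - 1) * expR (- t)).

Definition shifted_jacobi (R : realType) (a b : R) (n : nat) : {poly R} :=
  (pochhammer (a + 1) n / n`!%:R) *:
  \sum_(k < n.+1)
    (pochhammer (- n%:R) k * pochhammer (n%:R + a + b + 1) k /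
     (k`!%:R * pochhammer (a + 1) k)) *: (1 - 'X) ^+ k.

Definition jacobi_inner (R : realType) (alpha beta : R) (f g : {poly R}) : R :=
  \int[@lebesgue_measure R]_(x in `[0, 1])
    ((1 - x) `^ alpha * x `^ beta * f.[x] * g.[x]).

Definition bernstein (R : realType) (n i : nat) : {poly R} :=
  'C(n, i)%:R *: ('X^i * (1 - 'X) ^+ (n - i)).

(* [D] is the family of dual Bernstein polynomials of degree n, extended by 0
   to the indices i > n; for alpha, beta > -1 exactly one such D exists. *)
Definition is_dual_bernstein (R : realType) (alpha beta : R) (n : nat)
    (D : nat -> {poly R}) : Prop :=
  [/\ forall i : nat, (i <= n)%N -> (size (D i) <= n.+1)%N,
      forall i j : nat, (i <= n)%N -> (j <= n)%N ->
        jacobi_inner alpha beta (bernstein R n i) (D j) = (i == j)%:R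
    & forall i : nat, (n < i)%N -> D i = 0].

Definition sigma (R : realType) (alpha beta : R) : R := alpha + beta + 1.

Definition Kconst (R : realType) (alpha beta : R) : R :=
  Gamma (alpha + 1) * Gamma (beta + 1) / Gamma (sigma alpha beta + 1).

(* The truncated subtraction n + 1 - k is only meaningful for k <= n + 1. *)
Definition Cconst (R : realType) (alpha beta : R) (n k : nat) : R :=
  (-1) ^+ (n + 1 - k) *
  (((2 * n)%:R + sigma alpha beta + 2) * pochhammer (sigma alpha beta + 1) n /
   (Kconst alpha beta * pochhammer (alpha + 1) (n + 1 - k) *
    pochhammer (beta + 1) k)).

Definition Tpoly (R : realType) (alpha beta : R) (n i : nat) : {poly R} :=
  ((n%:R - i%:R) * (n%:R + alpha + 1)) *:
    ('X * shifted_jacobi alpha (beta + 1) n) +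
  ((i%:R + 1) * (n%:R + beta + 1)) *:
    ((1 - 'X) * shifted_jacobi (alpha + 1) beta n).

(* Main.v *)
Require Import Defs.
From mathcomp Require Import all_boot all_order all_algebra.
From mathcomp Require Import all_classical all_reals all_analysis.
From mathcomp Require Import measurable_realfun ring lra.

Import Order.TTheory GRing.Theory Num.Theory.

Local Open Scope ring_scope.

(** Write [L f] for the integral of [f] against the Jacobi weight
    [(1 - x)^alpha x^beta] on [0, 1], so that the inner product of [f] and [g]
    is [L (f * g)].

    Let [U] be the left-hand side.  Tested against [x^q (1 - x)^p] with
    [p + q = n - 1], the factors [1 - x] and [x] complete the test polynomial
    to multiples of the Bernstein polynomials of indices [q] and [q + 1], and
    the two pairings with the dual polynomials cancel because
    [(i + 1) C(n, i + 1) = (n - i) C(n, i)].  So [U], of degree at most [n + 1],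
    is orthogonal to all polynomials of degree less than [n]
    ([dual_combination_orth]).  The same holds for [x R_n^(alpha, beta + 1)] and
    [(1 - x) R_n^(alpha + 1, beta)], hence for the right-hand side, since the
    factors [x] and [1 - x] are absorbed in the weight.  A polynomial with this
    property that also vanishes at [0] and [1] is [x (1 - x) h] with
    [deg h < n]; orthogonality to [h] forces [h = 0] ([eq_orth01]).  It remains
    to compare the two sides at [0] and at [1].

    This needs [D_i] at the end points.  The polynomial
    [J = R_n^(alpha, beta + 1)] is orthogonal to every [x h] with [deg h < n],
    so [L (J f) = f(0) L(J)] when [deg f <= n].  For [f = D_i] the left-hand
    side is the coefficient of [J] on the [i]-th Bernstein polynomial, which
    gives [D_i(0)] ([dual_bernstein_at0]); the reflection [x |-> 1 - x] gives
    [D_i(1)].  The Bernstein form of the Jacobi polynomials is obtained by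
    showing that the explicit Bernstein sum and the hypergeometric sum are both
    orthogonal to lower degrees and agree at [1]: in both cases the pairing with
    [x^m] is an [n]-th finite difference of a polynomial of degree less than
    [n] ([altsum_pochhammer]).

    All of this uses only that [L] is linear, definite, and has the moments
    [L (x^q (1 - x)^p) = K (alpha + 1)_p (beta + 1)_q / (alpha + beta + 2)_(p + q)].
    The moments come from Euler's identity between the Beta and Gamma integrals
    ([egamma_mul]), which follows by exchanging integrals in
    [Gamma(a) Gamma(b)]. *)

(** * Rising factorials and finite differences *)

Section Pochhammer.
Context {R : realType}.
Implicit Types (c : R) (l m n k : nat).

Lemma pochhammer0 c : pochhammer c 0 = 1.
Proof. by rewrite /pochhammer big_ord0. Qed.

Lemma pochhammerSr c l : pochhammer c l.+1 = pochhammer c l * (c + l%:R).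
Proof. by rewrite /pochhammer big_ord_recr. Qed.

Lemma pochhammerD c m l :
  pochhammer c (m + l) = pochhammer c m * pochhammer (c + m%:R) l.
Proof.
elim: l => [|l IHl]; first by rewrite addn0 pochhammer0 mulr1.
by rewrite addnS !pochhammerSr IHl natrD -mulrA addrA.
Qed.

Lemma pochhammerSl c l : pochhammer c l.+1 = c * pochhammer (c + 1) l.
Proof. by rewrite -add1n pochhammerD pochhammerSr pochhammer0 mul1r addr0. Qed.

Lemma pochhammer_gt0 c l : 0 < c -> 0 < pochhammer c l.
Proof.
by move=> c0; apply: prodr_gt0 => j _; rewrite ltr_wpDr// ler0n.
Qed.

Lemma pochhammer_opp_nat n k : (k <= n)%N ->
  pochhammer (- n%:R : R) k = (-1) ^+ k * ('C(n, k) * k`!)%:R.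
Proof.
elim: k => [|k IHk] kn.
  by rewrite pochhammer0 expr0 bin0 fact0 !mul1r.
rewrite pochhammerSr IHk ?(ltnW kn)//.
have -> : ('C(n, k.+1) * k.+1`! = (n - k) * ('C(n, k) * k`!))%N.
  by rewrite factS mulnA [('C(n, k.+1) * _)%N]mulnC mul_bin_left mulnA.
by rewrite [in RHS]natrM natrB ?(ltnW kn)// exprS; ring.
Qed.

(** Up to the sign [(-1)^n], the [n]-th forward difference of [F] at [0]. *)
Definition altsum n (F : nat -> R) : R :=
  \sum_(k < n.+1) (-1) ^+ k * 'C(n, k)%:R * F k.

Lemma altsumS n F : altsum n.+1 F = altsum n (fun k => F k - F k.+1).
Proof.
rewrite /altsum big_ord_recl/=.
under eq_bigr => k _ do
  rewrite /bump leq0n add1n binS natrD mulrDr mulrDl.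
rewrite big_split/= addrA.
under [RHS]eq_bigr => k _ do rewrite mulrBr.
rewrite big_split/=; congr (_ + _).
  rewrite [RHS]big_ord_recl/= !bin0; congr (_ + _).
  by rewrite big_ord_recr/= bin_small// mulr0 mul0r addr0.
by apply: eq_bigr => k _; rewrite exprS; ring.
Qed.

Lemma eq_altsum n (F G : nat -> R) :
  (forall k, (k <= n)%N -> F k = G k) -> altsum n F = altsum n G.
Proof.
by move=> FG; apply: eq_bigr => k _; rewrite FG// -ltnS.
Qed.

Lemma altsumZ n c (F : nat -> R) : altsum n (fun k => c * F k) = c * altsum n F.
Proof. by rewrite /altsum mulr_sumr; apply: eq_bigr => k _; ring. Qed.

(** A rising factorial of [k] is a polynomial in [k], and one difference
    lowers its length by one: [(c + k)_(m + 1) - (c + k + 1)_(m + 1)] equals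
    [- (m + 1) (c + k + 1)_m]. *)
Lemma altsum_pochhammer n m c : (m < n)%N ->
  altsum n (fun k => pochhammer (c + k%:R) m) = 0.
Proof.
elim: n m c => // n IHn m c mn; rewrite altsumS.
case: m mn => [_|m mn].
  by rewrite /altsum big1// => k _; rewrite !pochhammer0 subrr mulr0.
under eq_altsum => k _.
  have -> : pochhammer (c + k%:R) m.+1 - pochhammer (c + k.+1%:R) m.+1
          = - m.+1%:R * pochhammer (c + 1 + k%:R) m.
    rewrite pochhammerSl pochhammerSr (_ : c + k.+1%:R = c + k%:R + 1);
      last by rewrite -natr1 addrA.
    by rewrite (_ : c + 1 + k%:R = c + k%:R + 1) -?natr1; ring.
  over.
by rewrite altsumZ IHn// mulr0.
Qed.

(** Partial fraction decomposition of [n! / (c (c + 1) ... (c + n))]. *)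
Lemma altsum_inv n c : 0 < c ->
  altsum n (fun k => (c + k%:R)^-1) = n`!%:R / pochhammer c n.+1.
Proof.
elim: n c => [|n IHn] c c0.
  by rewrite /altsum big_ord_recl big_ord0 pochhammerSr pochhammer0 bin0 fact0;
     rewrite expr0 addr0 !mul1r.
have altsumB : altsum n.+1 (fun k => (c + k%:R)^-1) =
    altsum n (fun k => (c + k%:R)^-1) - altsum n (fun k => (c + 1 + k%:R)^-1).
  rewrite altsumS /altsum -sumrB; apply: eq_bigr => k _.
  by rewrite mulrBr -natr1 addrA addrAC.
rewrite altsumB !IHn ?addr_gt0// [in RHS]pochhammerSl.
rewrite pochhammerSl pochhammerSr factS natrM -natr1.
have := pochhammer_gt0 (c + 1) n (addr_gt0 c0 ltr01).
have : 0 < c + 1 + n%:R by rewrite ltr_wpDr// addr_gt0.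
move: (pochhammer _ _) => P cn P0.
by field; rewrite !gt_eqF//.
Qed.

End Pochhammer.

(** * Functionals with the moments of the Jacobi weight *)

Section BetaFunctionals.
Context {R : realType}.
Implicit Types (a b c K : R) (L : {poly R} -> R) (f g : {poly R}).
Implicit Types (m n k i p q : nat).

(** The algebraic trace of integration against [(1 - x)^a x^b]: these moments
    determine [L], and they make sense without reference to an integral, which
    lets multiplication by [x] and reflection act on the parameters. *)
Definition beta_functional a b K L : Prop :=
  scalar L /\
  forall p q, L ('X^q * (1 - 'X) ^+ p) =
    K * (pochhammer (a + 1) p * pochhammer (b + 1) q /
         pochhammer (a + b + 2) (p + q)).

Definition definite L : Prop :=
  forall f, (forall x, 0 < x < 1 -> 0 <= f.[x]) -> L f = 0 -> f = 0.

Lemma scalarZ L c f : scalar L -> L (c *: f) = c * L f.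
Proof.
move=> Llin; have := Llin 1 0 0; rewrite scaler0 addr0 mul1r => L0.
have {}L0 : L 0 = 0 by lra.
by have := Llin c f 0; rewrite addr0 L0 addr0.
Qed.

Lemma scalarD L f g : scalar L -> L (f + g) = L f + L g.
Proof. by move=> Llin; rewrite -[f]scale1r Llin mul1r scale1r. Qed.

Lemma scalarB L f g : scalar L -> L (f - g) = L f - L g.
Proof. by move=> Llin; rewrite scalarD// -scaleN1r scalarZ// mulN1r. Qed.

Lemma scalar_sum L n (c : nat -> R) (F : nat -> {poly R}) : scalar L ->
  L (\sum_(k < n) c k *: F k) = \sum_(k < n) c k * L (F k).
Proof.
move=> Llin; elim: n => [|n IHn].
  by rewrite !big_ord0 -(scale0r 0) (scalarZ _ _ _ Llin) mul0r.
by rewrite !big_ord_recr/= scalarD// IHn scalarZ.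
Qed.

Lemma scalar_orth L n f g : scalar L ->
  (forall m, (m < n)%N -> L (f * 'X^m) = 0) -> (size g <= n)%N -> L (f * g) = 0.
Proof.
move=> Llin fX gn; rewrite -(coefK g) poly_def mulr_sumr.
under eq_bigr => k _ do rewrite -scalerAr.
rewrite (scalar_sum _ _ (fun k => g`_k) (fun k => f * 'X^k))// big1// => k _.
by rewrite fX ?mulr0// (leq_trans (ltn_ord k)).
Qed.

(** The factor [x] is absorbed in the weight. *)
Lemma beta_functional_mulX a b K L : -1 < a -> -1 < b ->
  beta_functional a b K L ->
  beta_functional a (b + 1) (K * (b + 1) / (a + b + 2)) (fun f => L ('X * f)).
Proof.
move=> a1 b1 [Llin Lm]; split.
  by move=> c f g; rewrite mulrDr -scalerAr Llin.
move=> p q; rewrite [in LHS]mulrA -exprS Lm pochhammerSl addnS pochhammerSl.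
rewrite (_ : a + (b + 1) + 2 = a + b + 2 + 1); last by ring.
have ab : 0 < a + b + 2 by lra.
have := pochhammer_gt0 (a + b + 2 + 1) (p + q) (addr_gt0 ab ltr01).
by move: (pochhammer _ _) => P P0; field; rewrite !gt_eqF.
Qed.

Lemma definite_mulX L : definite L -> definite (fun f => L ('X * f)).
Proof.
move=> Ldef f f0 /Ldef/= Lf; have : 'X * f = 0.
  by apply: Lf => x x01; rewrite hornerM hornerX mulr_ge0 ?f0//; case/andP: x01 => /ltW.
by move/eqP; rewrite mulf_eq0 polyX_eq0/= => /eqP.
Qed.

Lemma beta_functional_refl a b K L : beta_functional a b K L ->
  beta_functional b a K (fun f => L (f \Po (1 - 'X))).
Proof.
move=> [Llin Lm]; split.
  by move=> c f g; rewrite comp_polyD comp_polyZ Llin.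
move=> p q; rewrite rmorphM/= !rmorphXn/= rmorphB/= comp_polyX comp_polyC subKr.
by rewrite mulrC Lm [b + a]addrC [(q + p)%N]addnC [pochhammer (b + 1) _ * _]mulrC.
Qed.

Lemma horner_onem x : (1 - 'X : {poly R}).[x] = 1 - x.
Proof. by rewrite !hornerE. Qed.

Lemma comp_poly_onemK f : (f \Po (1 - 'X)) \Po (1 - 'X) = f.
Proof. by rewrite -comp_polyA comp_polyB comp_polyX comp_polyC subKr comp_polyXr. Qed.

Lemma definite_refl L : definite L -> definite (fun f => L (f \Po (1 - 'X))).
Proof.
move=> Ldef f f0 /Ldef/= Lf; rewrite -[f]comp_poly_onemK Lf ?comp_poly0// => x x01.
by rewrite horner_comp horner_onem f0//; lra.
Qed.

Lemma size_onem_exp p : size ((1 - 'X : {poly R}) ^+ p) = p.+1.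
Proof.
by rewrite -opprB exprNn -signr_odd; case: odd;
   rewrite ?expr1 ?mulN1r ?size_polyN ?expr0 ?mul1r size_exp_XsubC.
Qed.

Lemma size_sum_le I (r : seq I) (P : pred I) (F : I -> {poly R}) n :
  (forall j, P j -> size (F j) <= n)%N ->
  (size (\sum_(j <- r | P j) F j)%R <= n)%N.
Proof.
move=> Fn; elim/big_ind: _ => //; first by rewrite size_poly0.
by move=> f g fn gn; rewrite (leq_trans (size_polyD _ _))// geq_max fn.
Qed.

Lemma size_bernstein n k : (k <= n)%N -> (size (bernstein R n k) <= n.+1)%N.
Proof.
move=> kn; rewrite (leq_trans (size_scale_leq _ _))//.
by rewrite (leq_trans (size_polyMleq _ _))// size_polyXn size_onem_exp addnS/= addSn subnKC.
Qed.

Definition jacobi_bcoef a b n k : R :=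
  (-1) ^+ (n - k) * (pochhammer (a + 1) n * pochhammer (b + 1) n /
    (n`!%:R * pochhammer (a + 1) (n - k) * pochhammer (b + 1) k)).

(** The Bernstein expansion of [R_n^(a, b)]; see [shifted_jacobi_bernstein]. *)
Definition jacobi_bernstein a b n : {poly R} :=
  \sum_(k < n.+1) jacobi_bcoef a b n k *: bernstein R n k.

Lemma size_jacobi_bernstein a b n : (size (jacobi_bernstein a b n) <= n.+1)%N.
Proof.
apply: size_sum_le => k _; rewrite (leq_trans (size_scale_leq _ _))//.
by rewrite size_bernstein// -ltnS.
Qed.

Lemma size_shifted_jacobi a b n : (size (shifted_jacobi a b n) <= n.+1)%N.
Proof.
rewrite (leq_trans (size_scale_leq _ _))// size_sum_le// => k _.
by rewrite (leq_trans (size_scale_leq _ _))// size_onem_exp.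
Qed.

Lemma bernstein1 n k : (k <= n)%N -> (bernstein R n k).[1] = (k == n)%:R.
Proof.
move=> kn; rewrite hornerZ hornerM hornerXn horner_exp horner_onem subrr expr1n mul1r.
case: eqVneq => [->|kn']; first by rewrite binn subnn expr0 mulr1.
by rewrite expr0n subn_eq0 leqNgt ltn_neqAle kn' kn mulr0.
Qed.

Lemma bernstein0 n k : (bernstein R n k).[0] = (k == 0)%:R.
Proof.
rewrite hornerZ hornerM hornerXn horner_exp horner_onem subr0 expr1n mulr1.
by rewrite expr0n; case: eqP => [->|]; rewrite ?bin0 ?mulr1 ?mulr0.
Qed.

Lemma jacobi_bernstein1 a b n : -1 < b ->
  (jacobi_bernstein a b n).[1] = pochhammer (a + 1) n / n`!%:R.
Proof.
move=> b1; rewrite horner_sum big_ord_recr/= big1 ?add0r; last first.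
  move=> k _; rewrite hornerZ bernstein1 ?(ltnW (ltn_ord k))//.
  by rewrite ltn_eqF ?mulr0.
rewrite hornerZ bernstein1// eqxx mulr1 /jacobi_bcoef subnn expr0 pochhammer0.
rewrite mul1r mulr1.
have b0 : 0 < b + 1 by lra.
have nf : n`!%:R != 0 :> R by rewrite pnatr_eq0 -lt0n fact_gt0.
by field; rewrite nf gt_eqF// pochhammer_gt0.
Qed.

Lemma jacobi_bernstein0 a b n : -1 < a ->
  (jacobi_bernstein a b n).[0] = (-1) ^+ n * (pochhammer (b + 1) n / n`!%:R).
Proof.
move=> a1; rewrite horner_sum big_ord_recl/= big1 ?addr0; last first.
  by move=> k _; rewrite hornerZ bernstein0 mulr0.
rewrite hornerZ bernstein0 mulr1 /jacobi_bcoef subn0 pochhammer0 mulr1.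
have a0 : 0 < a + 1 by lra.
have nf : n`!%:R != 0 :> R by rewrite pnatr_eq0 -lt0n fact_gt0.
by congr (_ * _); field; rewrite nf gt_eqF// pochhammer_gt0.
Qed.

Lemma shifted_jacobi1 a b n :
  (shifted_jacobi a b n).[1] = pochhammer (a + 1) n / n`!%:R.
Proof.
rewrite hornerZ horner_sum big_ord_recl big1 => [|k _].
  by rewrite addr0 hornerZ expr0 hornerC fact0 !pochhammer0 !mulr1 divr1 mulr1.
by rewrite hornerZ horner_exp horner_onem subrr expr0n mulr0.
Qed.

Lemma sign_subn n k : (k <= n)%N -> (-1) ^+ (n - k) = (-1) ^+ n * (-1) ^+ k :> R.
Proof.
by move=> kn; rewrite -signr_odd oddB// signr_addb !signr_odd.
Qed.

(** The moment of the [k]-th term contributes [(b + 1)_(k + m)], and division by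
    [(b + 1)_k] leaves [(b + 1 + k)_m]: the pairing is an [n]-th difference of
    a polynomial of degree [m < n] in [k]. *)
Lemma jacobi_bernstein_orth a b K L n m : -1 < a -> -1 < b ->
  beta_functional a b K L -> (m < n)%N ->
  L (jacobi_bernstein a b n * 'X^m) = 0.
Proof.
move=> a1 b1 [Llin Lm] mn.
rewrite mulr_suml; under eq_bigr => k _ do rewrite -scalerAl.
rewrite (scalar_sum _ _ (fun k => jacobi_bcoef a b n k)
  (fun k => bernstein R n k * 'X^m))//.
transitivity (K * ((-1) ^+ n * (pochhammer (a + 1) n * pochhammer (b + 1) n /
    (n`!%:R * pochhammer (a + b + 2) (n + m)))) *
  altsum n (fun k => pochhammer (b + 1 + k%:R) m)); last first.
  by rewrite altsum_pochhammer ?mulr0.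
rewrite mulr_sumr; apply: eq_bigr => k _.
have kn : (k <= n)%N by rewrite -ltnS.
rewrite /bernstein -scalerAl scalarZ// (mulrAC 'X^k) -exprD Lm addnA subnK//.
rewrite [pochhammer (b + 1) (_ + _)]pochhammerD /jacobi_bcoef sign_subn//.
have a0 : 0 < a + 1 by lra.
have b0 : 0 < b + 1 by lra.
have ab : 0 < a + b + 2 by lra.
have nf : n`!%:R != 0 :> R by rewrite pnatr_eq0 -lt0n fact_gt0.
by field; rewrite nf !gt_eqF// pochhammer_gt0.
Qed.

(** With [s = a + b + 2] and [n = m + 1 + d], the [k]-th term contributes
    [(s + m + d)_k / (s)_(k + m)], which is [(s + m + k)_d] up to a constant
    factor: again an [n]-th difference, of a polynomial of degree [d < n]. *)
Lemma shifted_jacobi_orth a b K L n m : -1 < a -> -1 < b ->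
  beta_functional a b K L -> (m < n)%N ->
  L (shifted_jacobi a b n * 'X^m) = 0.
Proof.
move=> a1 b1 [Llin Lm] mn.
rewrite /shifted_jacobi -scalerAl scalarZ//.
rewrite mulr_suml; under eq_bigr => k _ do rewrite -scalerAl.
rewrite (scalar_sum _ _ (fun k => pochhammer (- n%:R) k * pochhammer (n%:R + a + b + 1) k /
     (k`!%:R * pochhammer (a + 1) k))
  (fun k => (1 - 'X) ^+ k * 'X^m))//.
set s := a + b + 2; set d := (n - m.+1)%N.
have nE : n = (m + d).+1 by rewrite /d -addSn subnKC.
have s0 : 0 < s by rewrite /s; lra.
apply/eqP; rewrite mulf_eq0; apply/orP; right; apply/eqP.
transitivity (K * pochhammer (b + 1) m / pochhammer s (m + d) *
  altsum n (fun k => pochhammer (s + m%:R + k%:R) d)); last first.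
  by rewrite altsum_pochhammer ?mulr0// nE ltnS leq_addl.
rewrite mulr_sumr; apply: eq_bigr => k _.
have kn : (k <= n)%N by rewrite -ltnS.
rewrite mulrC [_ * 'X^m]mulrC Lm pochhammer_opp_nat//.
rewrite -/s (_ : n%:R + a + b + 1 = s + (m + d)%:R); last first.
  by rewrite nE -natr1 /s; ring.
have e1 : pochhammer s (m + d) * pochhammer (s + (m + d)%:R) k =
          pochhammer s (k + m) * pochhammer (s + m%:R + k%:R) d.
  rewrite -pochhammerD addnC addnA pochhammerD natrD; congr (_ * pochhammer _ _).
  by ring.
have e2 : pochhammer (s + m%:R + k%:R) d =
    pochhammer s (m + d) * pochhammer (s + (m + d)%:R) k / pochhammer s (k + m).
  by rewrite e1 mulrC mulrA mulVf ?mul1r// gt_eqF// pochhammer_gt0.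
rewrite e2 natrM.
have a0 : 0 < a + 1 by lra.
have kf : k`!%:R != 0 :> R by rewrite pnatr_eq0 -lt0n fact_gt0.
by field; rewrite kf !gt_eqF// pochhammer_gt0.
Qed.

Lemma factor_1subX f : f.[1] = 0 -> exists2 g, f = (1 - 'X) * g & (size g <= (size f).-1)%N.
Proof.
move=> /eqP f1; have /factor_theorem[g fE] : root f 1 by [].
exists (- g); first by rewrite fE mulrN -mulNr opprB polyC1 mulrC.
rewrite size_polyN fE; have [->|g0] := eqVneq g 0; first by rewrite size_poly0.
by rewrite size_Mmonic ?monicXsubC// size_XsubC addn2.
Qed.

(** The difference of [f] and [g] is [(1 - x) h] with [h] of degree less than
    [n]; pairing it with [h] gives an integral of [(1 - x) h^2]. *)
Lemma eq_orth1 L n f g : scalar L -> definite L ->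
  (size f <= n.+1)%N -> (size g <= n.+1)%N ->
  (forall m, (m < n)%N -> L (f * 'X^m) = 0) ->
  (forall m, (m < n)%N -> L (g * 'X^m) = 0) ->
  f.[1] = g.[1] -> f = g.
Proof.
move=> Llin Ldef fn gn fX gX fg1; apply/eqP; rewrite -subr_eq0; apply/eqP.
set u := f - g.
have un : (size u <= n.+1)%N.
  by rewrite (leq_trans (size_polyD _ _))// geq_max fn size_polyN.
have uX m : (m < n)%N -> L (u * 'X^m) = 0.
  by move=> mn; rewrite /u mulrBl scalarB// fX// gX// subrr.
have /factor_1subX[h uE hn] : u.[1] = 0 by rewrite /u !hornerE fg1 subrr.
have hn' : (size h <= n)%N by rewrite (leq_trans hn)// -subn1 leq_subLR.
have /Ldef Lh := scalar_orth L n u h Llin uX hn'.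
have : u * h = 0.
  apply: Lh => x x01; rewrite uE -mulrA !hornerM horner_onem -expr2.
  by rewrite mulr_ge0 ?sqr_ge0//; lra.
by rewrite uE => /eqP; rewrite mulf_eq0 => /orP[/eqP//|/eqP->]; rewrite mulr0.
Qed.

Lemma shifted_jacobi_bernstein a b K L n : -1 < a -> -1 < b ->
  beta_functional a b K L -> definite L ->
  shifted_jacobi a b n = jacobi_bernstein a b n.
Proof.
move=> a1 b1 Lbeta Ldef; have [Llin _] := Lbeta.
apply: (@eq_orth1 L n) => //.
- exact: size_shifted_jacobi.
- exact: size_jacobi_bernstein.
- by move=> m; apply: shifted_jacobi_orth Lbeta.
- by move=> m; apply: jacobi_bernstein_orth Lbeta.
- by rewrite shifted_jacobi1 jacobi_bernstein1.
Qed.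

(** Each Bernstein polynomial contributes [(b + 1)_k / (b + 2)_k], that is
    [(b + 1) / (b + 1 + k)], so the sum is the one of [altsum_inv]. *)
Lemma beta_functional_jacobi a b K L n : -1 < a -> -1 < b ->
  beta_functional a b K L ->
  L (jacobi_bernstein a (b + 1) n) =
    K * ((-1) ^+ n * (pochhammer (a + 1) n / pochhammer (a + b + 2) n)).
Proof.
move=> a1 b1 [Llin Lm].
rewrite (scalar_sum _ _ (fun k => jacobi_bcoef a (b + 1) n k)
  (fun k => bernstein R n k))//.
have a0 : 0 < a + 1 by lra.
have b0 : 0 < b + 1 by lra.
have ab : 0 < a + b + 2 by lra.
have nf : n`!%:R != 0 :> R by rewrite pnatr_eq0 -lt0n fact_gt0.
transitivity (K * ((-1) ^+ n * (pochhammer (a + 1) n * pochhammer (b + 1) n.+1 /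
    (n`!%:R * pochhammer (a + b + 2) n))) *
  altsum n (fun k => (b + 1 + k%:R)^-1)); last first.
  rewrite altsum_inv//.
  by field; rewrite nf !gt_eqF// pochhammer_gt0.
rewrite mulr_sumr; apply: eq_bigr => k _.
have kn : (k <= n)%N by rewrite -ltnS.
rewrite /bernstein scalarZ// Lm subnK// /jacobi_bcoef sign_subn//.
have e : pochhammer (b + 1) k = (b + 1) * pochhammer (b + 1 + 1) k / (b + 1 + k%:R).
  rewrite -pochhammerSl pochhammerSr mulfK// gt_eqF// ltr_wpDr//.
rewrite e pochhammerSl.
have bk : 0 < b + 1 + k%:R by rewrite ltr_wpDr.
by field; rewrite nf !gt_eqF// pochhammer_gt0// addr_gt0.
Qed.

(** [f - f(0)] is [x g] with [g] of degree less than [n], and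
    [R_n^(a, b + 1)] is orthogonal to such [g] for the weight that has absorbed
    [x]: up to a factor this polynomial is the reproducing kernel at [0]. *)
Lemma jacobi_bernstein_reproducing a b K L n f : -1 < a -> -1 < b ->
  beta_functional a b K L -> (size f <= n.+1)%N ->
  L (jacobi_bernstein a (b + 1) n * f) = f.[0] * L (jacobi_bernstein a (b + 1) n).
Proof.
move=> a1 b1 Lbeta fn; have [Llin _] := Lbeta.
have /eqP f0 : (f - f.[0]%:P).[0] = 0 by rewrite !hornerE subrr.
have /factor_theorem[g] : root (f - f.[0]%:P) 0 by [].
rewrite subr0 => fE.
have fE' : f = f.[0] *: 1 + 'X * g.
  by rewrite alg_polyC addrC [X in X + _]mulrC -fE subrK.
have gn : (size g <= n)%N.
  have [->|g0] := eqVneq g 0; first by rewrite size_poly0.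
  rewrite -ltnS -(size_mulX g0) -fE (leq_trans (size_polyD _ _))// geq_max fn.
  by rewrite size_polyN (leq_trans (size_polyC_leq1 _)).
set J := jacobi_bernstein _ _ _.
rewrite [in LHS]fE' mulrDr -scalerAr mulr1 Llin mulrCA.
suff -> : L ('X * (J * g)) = 0 by rewrite addr0.
have L'beta := beta_functional_mulX _ _ _ _ a1 b1 Lbeta.
apply: (scalar_orth (fun f => L ('X * f)) n) => //; first by case: L'beta.
by move=> m mn; apply: (jacobi_bernstein_orth _ _ _ _ _ _ _ _ L'beta) => //; lra.
Qed.

(** Pairing [f] with [R_n^(a, b + 1)] in two ways: duality picks out the [i]-th
    Bernstein coefficient, and the reproducing property gives [f(0)]. *)
Lemma dual_bernstein_at0 a b K L n i f : -1 < a -> -1 < b -> K != 0 ->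
  beta_functional a b K L -> (i <= n)%N -> (size f <= n.+1)%N ->
  (forall k, (k <= n)%N -> L (bernstein R n k * f) = (k == i)%:R) ->
  f.[0] = (-1) ^+ i * (pochhammer (b + 2) n * pochhammer (a + b + 2) n /
    (K * n`!%:R * pochhammer (a + 1) (n - i) * pochhammer (b + 2) i)).
Proof.
move=> a1 b1 K0 Lbeta iN fn Lf; have [Llin _] := Lbeta.
have := jacobi_bernstein_reproducing _ _ _ _ _ _ a1 b1 Lbeta fn.
have -> : L (jacobi_bernstein a (b + 1) n * f) = jacobi_bcoef a (b + 1) n i.
  rewrite mulr_suml; under eq_bigr => k _ do rewrite -scalerAl.
  rewrite (scalar_sum _ _ (fun k => jacobi_bcoef a (b + 1) n k)
    (fun k => bernstein R n k * f))//.
  have iN' : (i < n.+1)%N by [].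
  rewrite (bigD1 (Ordinal iN'))//= Lf// eqxx mulr1 big1 ?addr0// => k.
  by rewrite -val_eqE/= => ki; rewrite Lf ?(negbTE ki) ?mulr0// -ltnS.
rewrite (beta_functional_jacobi _ _ _ _ _ a1 b1 Lbeta) /jacobi_bcoef => fE.
have a0 : 0 < a + 1 by lra.
have b0 : 0 < b + 2 by lra.
have ab : 0 < a + b + 2 by lra.
have nf : n`!%:R != 0 :> R by rewrite pnatr_eq0 -lt0n fact_gt0.
move: fE; rewrite (_ : b + 1 + 1 = b + 2); last by ring.
have Pa := pochhammer_gt0 (a + 1) n a0.
have Ps := pochhammer_gt0 (a + b + 2) n ab.
have L0 : K * ((-1) ^+ n * (pochhammer (a + 1) n / pochhammer (a + b + 2) n)) != 0.
  by rewrite !mulf_neq0// ?signr_eq0// ?invr_eq0 gt_eqF.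
move=> fE; rewrite -[LHS](mulfK L0) -fE.
rewrite sign_subn//; field.
by rewrite signr_eq0 nf K0 !gt_eqF ?pochhammer_gt0.
Qed.

(** Write [f = x (1 - x) h]; then [L (f * h)] is an integral of
    [x (1 - x) h^2]. *)
Lemma eq_orth01 L n f : scalar L -> definite L -> (size f <= n.+2)%N ->
  (forall m, (m < n)%N -> L (f * 'X^m) = 0) ->
  f.[0] = 0 -> f.[1] = 0 -> f = 0.
Proof.
move=> Llin Ldef fn fX f0 /factor_1subX[g fE gn].
have /eqP g0 : g.[0] = 0.
  by move: f0; rewrite fE hornerM horner_onem subr0 mul1r => ->.
have /factor_theorem[h] : root g 0 by [].
rewrite subr0 => gE.
have hn : (size h <= n)%N.
  have [->|h0] := eqVneq h 0; first by rewrite size_poly0.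
  by rewrite -ltnS -(size_mulX h0) -gE (leq_trans gn)// -subn1 leq_subLR.
have /Ldef Lh := scalar_orth L n f h Llin fX hn.
have : f * h = 0.
  apply: Lh => x x01; rewrite fE gE !hornerM horner_onem hornerX.
  rewrite (_ : _ * _ = (1 - x) * x * h.[x] ^+ 2); last by ring.
  by rewrite mulr_ge0 ?sqr_ge0// mulr_ge0; lra.
move/eqP; rewrite mulf_eq0 => /orP[/eqP//|/eqP h0].
by rewrite fE gE h0 mul0r mulr0.
Qed.

(** Multiply [x^m] by a power of [(1 - x) + x = 1]. *)
Lemma Xn_bernstein_span m n : (m <= n)%N ->
  'X^m = \sum_(j < (n - m).+1) 'C(n - m, j)%:R *:
           ('X^(m + j) * (1 - 'X) ^+ (n - m - j)) :> {poly R}.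
Proof.
move=> mn; have -> : 'X^m = 'X^m * ((1 - 'X) + 'X) ^+ (n - m) :> {poly R}.
  by rewrite subrK expr1n mulr1.
rewrite exprDn mulr_sumr; apply: eq_bigr => j _.
by rewrite exprD -mulrA [(1 - 'X) ^+ _ * _]mulrC scaler_nat !mulrnAr.
Qed.

End BetaFunctionals.

(** * The identity for dual Bernstein families *)

Section DualIdentity.
Context {R : realType}.
Context (alpha beta K : R) (L : {poly R} -> R) (n : nat) (D : nat -> {poly R}).
Context (halpha : -1 < alpha) (hbeta : -1 < beta) (K0 : K != 0).
Context (Lbeta : beta_functional alpha beta K L) (Ldef : definite L).
Context (sizeD : forall i : nat, (i <= n)%N -> (size (D i) <= n.+1)%N).
Context (dualD : forall i j : nat, (i <= n)%N -> (j <= n)%N ->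
  L (bernstein R n i * D j) = (i == j)%:R).

Let Llin : scalar L. Proof. by case: Lbeta. Qed.

Lemma bernstein_refl m k : (k <= m)%N ->
  bernstein R m k \Po (1 - 'X) = bernstein R m (m - k).
Proof.
move=> km; rewrite /bernstein comp_polyZ rmorphM/= !rmorphXn/= rmorphB/= comp_polyX.
by rewrite comp_polyC subKr bin_sub// subKn// mulrC.
Qed.

Let LB q p j : n = (p + q)%N -> (j <= n)%N ->
  L ('X^q * (1 - 'X) ^+ p * D j) = (q == j)%:R / 'C(n, q)%:R.
Proof.
move=> nE jn; have qn : (q <= n)%N by rewrite nE leq_addl.
have C0 : 'C(n, q)%:R != 0 :> R by rewrite pnatr_eq0 -lt0n bin_gt0.
rewrite -dualD// /bernstein -scalerAl scalarZ// [RHS]mulrC mulKf//.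
by rewrite nE addnK.
Qed.

(** Against [x^q (1 - x)^p] with [p + q = n - 1] the two terms pair to
    [- (i + 1) / C(n, i)] and [(n - i) / C(n, i + 1)] when [q = i], and to [0]
    otherwise.  For [i = n] only the first term is present, and [q < n]. *)
Lemma dual_combination_orth i m : (i <= n)%N -> (m < n)%N ->
  L (((i%:R + 1) *: (('X - 1) * D i) + (n%:R - i%:R) *: ('X * D i.+1)) * 'X^m) = 0.
Proof.
move=> iN mn.
have n0 : (0 < n)%N by apply: leq_ltn_trans mn.
have mn1 : (m <= n.-1)%N by rewrite -ltnS prednK.
rewrite (Xn_bernstein_span _ _ mn1) mulr_sumr.
under eq_bigr => j _ do rewrite -scalerAr.
rewrite (scalar_sum L _ (fun j => 'C(n.-1 - m, j)%:R)
  (fun j => _ * ('X^(m + j) * (1 - 'X) ^+ (n.-1 - m - j))))//.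
apply: big1 => j _; apply/eqP; rewrite mulf_eq0; apply/orP; right; apply/eqP.
set q := (m + j)%N; set p := (n.-1 - m - j)%N.
have jn : (j <= n.-1 - m)%N by rewrite -ltnS.
have nE : n = (p.+1 + q)%N.
  by rewrite /p /q addSn addnCA addnC subnK// subnK// prednK.
rewrite mulrDl -!scalerAl Llin scalarZ//.
have -> : ('X - 1) * D i * ('X^q * (1 - 'X) ^+ p) =
    -1 *: ('X^q * (1 - 'X) ^+ p.+1 * D i) :> {poly R}.
  by rewrite scaleN1r exprS; ring.
have -> : 'X * D i.+1 * ('X^q * (1 - 'X) ^+ p) = 'X^(q.+1) * (1 - 'X) ^+ p * D i.+1.
  by rewrite exprS; ring.
rewrite scalarZ// LB//.
have [iN'|iN'] := ltnP i n; last first.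
  have -> : i = n by apply/eqP; rewrite eqn_leq iN.
  rewrite subrr mul0r addr0 ltn_eqF ?mul0r ?mulr0//.
  by rewrite [X in (_ < X)%N]nE addSn ltnS leq_addl.
rewrite (LB q.+1 p)//; last by rewrite addnS -addSn.
rewrite eqSS; case: eqVneq => [->|_]; last by rewrite !mul0r !mulr0 addr0.
have Ci : 'C(n, i)%:R != 0 :> R by rewrite pnatr_eq0 -lt0n bin_gt0.
have Ci1 : 'C(n, i.+1)%:R != 0 :> R by rewrite pnatr_eq0 -lt0n bin_gt0.
have := mul_bin_left n i; move/(congr1 (fun k => k%:R : R)).
rewrite !natrM natrB// -natr1 => e.
apply: (mulIf Ci); apply: (mulIf Ci1); rewrite mul0r mul0r.
transitivity ((n%:R - i%:R) * 'C(n, i)%:R - (i%:R + 1) * 'C(n, i.+1)%:R : R).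
  by rewrite /=; field; rewrite Ci Ci1.
by rewrite e subrr.
Qed.

Lemma dual_at0 i : (i <= n)%N ->
  (D i).[0] = (-1) ^+ i * (pochhammer (beta + 2) n * pochhammer (alpha + beta + 2) n /
    (K * n`!%:R * pochhammer (alpha + 1) (n - i) * pochhammer (beta + 2) i)).
Proof.
move=> iN; apply: (@dual_bernstein_at0 _ _ _ _ L) => //; first exact: sizeD.
by move=> k kn; exact: dualD.
Qed.

(** The reflected family is dual for the exchanged parameters, with index
    [n - i] in place of [i]. *)
Lemma dual_at1 i : (i <= n)%N ->
  (D i).[1] = (-1) ^+ (n - i) * (pochhammer (alpha + 2) n * pochhammer (alpha + beta + 2) n /
    (K * n`!%:R * pochhammer (beta + 1) i * pochhammer (alpha + 2) (n - i))).
Proof.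
move=> iN; have -> : (D i).[1] = (D i \Po (1 - 'X)).[0].
  by rewrite horner_comp horner_onem subr0.
rewrite (dual_bernstein_at0 _ _ _ _ n (n - i)%N _ hbeta halpha K0
  (beta_functional_refl _ _ _ _ Lbeta)) ?leq_subr ?subKn//.
- by rewrite [beta + alpha]addrC.
- rewrite (leq_trans (size_comp_poly_leq _ _))//.
  have -> : size (1 - 'X : {poly R}) = 2 by rewrite -[1 - 'X]expr1 size_onem_exp.
  by rewrite muln1 ltnS -subn1 leq_subLR add1n sizeD.
- move=> k kn; rewrite rmorphM/= comp_poly_onemK bernstein_refl// dualD ?leq_subr//.
  by rewrite -(eqn_add2r k) subnK// -[in RHS](eqn_add2l i) subnKC// eq_sym.
Qed.

Let LXbeta := beta_functional_mulX _ _ _ _ halpha hbeta Lbeta.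

Lemma shifted_jacobi_mulX_orth m : (m < n)%N ->
  L ('X * shifted_jacobi alpha (beta + 1) n * 'X^m) = 0.
Proof.
move=> mn; rewrite -mulrA; apply: shifted_jacobi_orth LXbeta mn => //; have := hbeta; lra.
Qed.

Let L1X f := L ((1 - 'X) * f).

(* Multiplication by [1 - x] is multiplication by [x] between two reflections. *)
Let L1Xbeta : exists K', beta_functional (alpha + 1) beta K' L1X.
Proof.
have Rbeta := beta_functional_refl _ _ _ _ Lbeta.
have := beta_functional_refl _ _ _ _ (beta_functional_mulX _ _ _ _ hbeta halpha Rbeta).
rewrite (_ : (fun f => _) = L1X); last first.
  by apply/funext => f; rewrite rmorphM/= comp_polyX comp_poly_onemK.
by move=> ?; eexists; eassumption.
Qed.

Let L1Xdef : definite L1X.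
Proof.
have := definite_refl _ (definite_mulX _ (definite_refl _ Ldef)).
rewrite (_ : (fun f => _) = L1X)//.
by apply/funext => f; rewrite rmorphM/= comp_polyX comp_poly_onemK.
Qed.

Lemma shifted_jacobi_mul1X_orth m : (m < n)%N ->
  L ((1 - 'X) * shifted_jacobi (alpha + 1) beta n * 'X^m) = 0.
Proof.
move=> mn; have [K' L'beta] := L1Xbeta.
rewrite -mulrA; apply: shifted_jacobi_orth L'beta mn => //; have := halpha; lra.
Qed.

Lemma shifted_jacobi_mul1X_at0 :
  (shifted_jacobi (alpha + 1) beta n).[0] =
  (-1) ^+ n * (pochhammer (beta + 1) n / n`!%:R).
Proof.
have [K' L'beta] := L1Xbeta.
rewrite (shifted_jacobi_bernstein _ _ _ _ _ _ _ L'beta)//; last by have := halpha; lra.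
by rewrite jacobi_bernstein0//; have := halpha; lra.
Qed.

Lemma horner_combination c d f g x :
  (c *: (('X - 1) * f) + d *: ('X * g)).[x] =
  c * ((x - 1) * f.[x]) + d * (x * g.[x]) :> R.
Proof. by rewrite hornerD !hornerZ !hornerM hornerX -polyC1 hornerXsubC. Qed.

Lemma horner_Tpoly i x : (Tpoly alpha beta n i).[x] =
  (n%:R - i%:R) * (n%:R + alpha + 1) * (x * (shifted_jacobi alpha (beta + 1) n).[x]) +
  (i%:R + 1) * (n%:R + beta + 1) * ((1 - x) * (shifted_jacobi (alpha + 1) beta n).[x]).
Proof.
rewrite /Tpoly; move: (shifted_jacobi alpha _ _) (shifted_jacobi (alpha + 1) _ _).
by move=> f g; rewrite hornerD !hornerZ !hornerM hornerX horner_onem.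
Qed.

(** At [0] only the terms in [D i] and [R_n^(alpha + 1, beta)] survive, at [1]
    only those in [D i.+1] and [R_n^(alpha, beta + 1)]. *)
Lemma dual_bernstein_identity i : (i <= n)%N ->
  (i%:R + 1) *: (('X - 1) * D i) + (n%:R - i%:R) *: ('X * D i.+1) =
  (- (-1) ^+ (n - i) * (pochhammer (alpha + beta + 2) n /
    (K * pochhammer (alpha + 1) (n - i) * pochhammer (beta + 1) i.+1))) *:
    Tpoly alpha beta n i.
Proof.
move=> iN; apply/eqP; rewrite -subr_eq0; apply/eqP.
set c := (X in X *: Tpoly _ _ _ _).
have a1 : 0 < alpha + 1 by have := halpha; lra.
have b1 : 0 < beta + 1 by have := hbeta; lra.
have a2 : 0 < alpha + 2 by lra.
have b2 : 0 < beta + 2 by lra.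
have nf : n`!%:R != 0 :> R by rewrite pnatr_eq0 -lt0n fact_gt0.
apply: (@eq_orth01 _ L n) => //.
- rewrite (leq_trans (size_polyD _ _))// geq_max size_polyN; apply/andP; split.
    have size1 : size ('X - 1 : {poly R}) = 2%N by rewrite size_XsubC.
    rewrite (leq_trans (size_polyD _ _))// geq_max; apply/andP; split.
      rewrite (leq_trans (size_scale_leq _ _))// (leq_trans (size_polyMleq _ _))//.
      by rewrite size1 add2n/= ltnS sizeD.
    have [iN'|iN'] := ltnP i n; last first.
      have -> : i = n by apply/eqP; rewrite eqn_leq iN.
      by rewrite subrr scale0r size_poly0.
    rewrite (leq_trans (size_scale_leq _ _))// (leq_trans (size_polyMleq _ _))//.
    by rewrite size_polyX add2n/= ltnS sizeD.
  rewrite (leq_trans (size_scale_leq _ _))// (leq_trans (size_polyD _ _))// geq_max.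
  have sizeJ a b : (size (shifted_jacobi a b n) < n.+2)%N by rewrite ltnS size_shifted_jacobi.
  apply/andP; split; rewrite (leq_trans (size_scale_leq _ _))// (leq_trans (size_polyMleq _ _))//.
    by rewrite size_polyX add2n/= sizeJ.
  by rewrite -[1 - 'X]expr1 size_onem_exp add2n/= sizeJ.
- move=> m mn; rewrite mulrBl scalarB// dual_combination_orth// sub0r.
  rewrite -scalerAl scalarZ// mulrDl -!scalerAl Llin scalarZ//.
  by rewrite shifted_jacobi_mulX_orth// shifted_jacobi_mul1X_orth// !mulr0 addr0 mulr0 oppr0.
- rewrite hornerD hornerN hornerZ horner_combination horner_Tpoly.
  rewrite dual_at0// shifted_jacobi_mul1X_at0 /c sign_subn// pochhammerSl.
  rewrite (_ : beta + 1 + 1 = beta + 2); last by ring.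
  have -> : pochhammer (beta + 2) n =
      pochhammer (beta + 1) n * (beta + 1 + n%:R) / (beta + 1).
    rewrite -pochhammerSr pochhammerSl mulrC mulKf ?gt_eqF//.
    by congr pochhammer; ring.
  (* The square of [(-1) ^+ n] occurs; splitting on parity makes it [1]. *)
  rewrite -(signr_odd _ n); case: (odd n); rewrite ?expr0 ?expr1; field.
    by rewrite K0 nf !gt_eqF ?pochhammer_gt0.
  by rewrite K0 nf !gt_eqF ?pochhammer_gt0.
- rewrite hornerD hornerN hornerZ horner_combination horner_Tpoly.
  rewrite shifted_jacobi1 /c.
  have [iN'|iN'] := ltnP i n; last first.
    have -> : i = n by apply/eqP; rewrite eqn_leq iN.
    by ring.
  rewrite (dual_at1 i.+1)// -(subnSK iN') exprS [pochhammer (alpha + 1) _.+1]pochhammerSl.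
  rewrite (_ : alpha + 1 + 1 = alpha + 2); last by ring.
  have -> : pochhammer (alpha + 2) n =
      pochhammer (alpha + 1) n * (alpha + 1 + n%:R) / (alpha + 1).
    rewrite -pochhammerSr pochhammerSl mulrC mulKf ?gt_eqF//.
    by congr pochhammer; ring.
  by field; rewrite K0 nf !gt_eqF ?pochhammer_gt0.
Qed.
End DualIdentity.

(** * The Beta and Gamma integrals *)

Section EulerIntegrals.
Local Open Scope classical_set_scope.
Context {R : realType}.
Notation mu := (@lebesgue_measure R).
Implicit Types (a b c d s t u v x z : R) (n m : nat).

Let affine_measurable c d : measurable_fun [set: R] (fun x => c * x + d).
Proof. by apply: measurable_funD => //; exact: measurable_funM. Qed.

(** The image of Lebesgue measure under [x |-> c x + d], multiplied by [c],
    agrees with Lebesgue measure on half-open intervals. *)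
Lemma integral_affine c d (f : R -> \bar R) : 0 < c ->
  measurable_fun [set: R] f -> (forall x, 0 <= f x)%E ->
  (\int[mu]_x f x = c%:E * \int[mu]_x f (c * x + d)%R)%E.
Proof.
move=> c0 mf f0.
pose phi : measurableTypeR R -> measurableTypeR R := fun x => c * x + d.
have mphi : measurable_fun setT phi by exact: affine_measurable.
pose image := measure_function_pushforward__canonical__measure_function_Measure mu mphi.
pose nu : {measure set (measurableTypeR R) -> \bar R} :=
  mscale (NngNum (ltW c0)) image.
have munu A : measurable A -> mu A = nu A.
  apply: lebesgue_measure_unique => X [[u v] _ <-]/=.
  rewrite /nu/= /mscale/= /pushforward/=.
  have -> : phi @^-1` `]u, v]%classic = `](u - d) / c, (v - d) / c]%classic.
    apply/seteqP; split => x/=; rewrite !in_itv/= /phi.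
      by rewrite ltr_pdivrMr// ler_pdivlMr// mulrC ltrBlDr lerBrDr.
    by rewrite ltr_pdivrMr// ler_pdivlMr// mulrC ltrBlDr lerBrDr.
  rewrite !lebesgue_measure_itv/= !lte_fin ltr_pM2r ?invr_gt0// ltrD2r.
  case: ifP => _; last by rewrite mule0.
  by rewrite -!EFinB -EFinM; congr EFin; field; rewrite gt_eqF.
rewrite (eq_measure_integral nu); last by move=> A mA _; exact: munu.
rewrite ge0_integral_mscale//= ge0_integral_pushforward//.
Qed.

(** The integrands of Euler's integrals, extended by [0] to the whole line so
    that substitutions and exchanges need no bookkeeping of domains. *)
Definition gamma_kernel z t : R := \1_`]0, +oo[ t * (t `^ (z - 1) * expR (- t)).

Definition beta_kernel a b x : R :=
  \1_`]0, 1[ x * (x `^ (a - 1) * (1 - x) `^ (b - 1)).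

Lemma measurable_gamma_kernel z : measurable_fun setT (gamma_kernel z).
Proof.
apply: measurable_funM; first exact: measurable_indic.
by apply: measurable_funM => //; apply: measurableT_comp.
Qed.

Lemma measurable_beta_kernel a b : measurable_fun setT (beta_kernel a b).
Proof.
apply: measurable_funM; first exact: measurable_indic.
apply: measurable_funM => //.
apply: (@measurableT_comp _ _ _ _ _ _ (fun x => x `^ (b - 1))) => //.
exact: measurable_funB.
Qed.

Lemma gamma_kernelE z t : 0 < t -> gamma_kernel z t = t `^ (z - 1) * expR (- t).
Proof. by move=> t0; rewrite /gamma_kernel indicE mem_set ?mul1r//= in_itv/= t0. Qed.

Lemma gamma_kernel_le0 z t : t <= 0 -> gamma_kernel z t = 0.
Proof.
move=> t0; rewrite /gamma_kernel indicE memNset ?mul0r//= in_itv/= andbT.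
by rewrite ltNge t0.
Qed.

Lemma gamma_kernel_ge0 z t : 0 <= gamma_kernel z t.
Proof. by rewrite !mulr_ge0// ?powR_ge0 ?expR_ge0. Qed.

Lemma beta_kernelE a b x : 0 < x < 1 ->
  beta_kernel a b x = x `^ (a - 1) * (1 - x) `^ (b - 1).
Proof. by move=> x01; rewrite /beta_kernel indicE mem_set ?mul1r//= in_itv. Qed.

Lemma beta_kernel_out a b x : ~~ (0 < x < 1) -> beta_kernel a b x = 0.
Proof.
move=> x01; rewrite /beta_kernel indicE memNset ?mul0r//= in_itv/=.
exact/negP.
Qed.

Lemma beta_kernel_ge0 a b x : 0 <= beta_kernel a b x.
Proof. by rewrite !mulr_ge0// ?powR_ge0. Qed.

(** Extended-real values, for which no finiteness has to be known in
    advance. *)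
Definition egamma z : \bar R := (\int[mu]_t (gamma_kernel z t)%:E)%E.

Definition ebeta a b : \bar R := (\int[mu]_x (beta_kernel a b x)%:E)%E.

Let gamma_kernel_dilation a b v x : 0 < v ->
  v * (gamma_kernel a (v * x + 0) * gamma_kernel b (v - (v * x + 0))) =
  beta_kernel a b x * gamma_kernel (a + b) v.
Proof.
move=> v0; rewrite addr0.
have [x01|x01] := boolP (0 < x < 1); last first.
  rewrite beta_kernel_out// mul0r; move: x01; rewrite negb_and -!leNgt => /orP[x0|x1].
    by rewrite gamma_kernel_le0 ?mul0r ?mulr0// pmulr_rle0.
  by rewrite [X in _ * (_ * X)]gamma_kernel_le0 ?mulr0// subr_le0 ler_pMr.
have /andP[x0 x1] := x01.
have x1' : 0 < 1 - x by rewrite subr_gt0.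
have -> : v - v * x = v * (1 - x) by ring.
rewrite beta_kernelE// !gamma_kernelE ?mulr_gt0// !powRM ?ltW//.
have -> : expR (- (v * x)) = expR (- v) / expR (- (v * (1 - x))).
  by rewrite -expRB; congr expR; ring.
have -> : v `^ (a + b - 1) = v * v `^ (a - 1) * v `^ (b - 1).
  rewrite -{2}[v](powRr1 (ltW v0)) -!powRD ?(gt_eqF v0) ?implybT//.
  by congr (_ `^ _); ring.
by field; rewrite gt_eqF ?expR_gt0.
Qed.

(** The product is the integral of [g_a(s) g_b(v - s)] over [s] and [v], where
    [g_a] and [g_b] are the two integrands.  Exchange the integrals and
    substitute [s = v x] in the inner one: the homogeneity expressed by
    [gamma_kernel_dilation] separates [x] from [v]. *)
Lemma egamma_mul a b : (egamma a * egamma b = ebeta a b * egamma (a + b))%E.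
Proof.
have mg z := measurable_gamma_kernel z.
have ge z t : (0 <= (gamma_kernel z t)%:E)%E by rewrite lee_fin gamma_kernel_ge0.
have eb x : (0 <= (beta_kernel a b x)%:E)%E by rewrite lee_fin beta_kernel_ge0.
rewrite /egamma -ge0_integralZr//; last 2 first.
- by apply/measurable_EFinP; apply: mg.
- exact: integral_ge0.
transitivity (\int[mu]_s \int[mu]_v
    (gamma_kernel a s * gamma_kernel b (v - s))%:E)%E.
  apply: eq_integral => s _.
  rewrite (integral_affine 1 (- s))//; last by apply/measurable_EFinP; apply: mg.
  rewrite mul1e -ge0_integralZl//; last first.
    apply/measurable_EFinP; apply: measurableT_comp => //; exact: affine_measurable.
  by apply: eq_integral => v _; rewrite mul1r EFinM.
transitivity (\int[mu]_v \int[mu]_s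
    (gamma_kernel a s * gamma_kernel b (v - s))%:E)%E.
  pose f (p : measurableTypeR R * measurableTypeR R) :=
    (gamma_kernel a p.1 * gamma_kernel b (p.2 - p.1))%:E.
  apply: (@fubini_tonelli _ _ _ _ _ mu mu f).
    apply/measurable_EFinP; apply: measurable_funM.
      by apply: measurableT_comp; [exact: mg|exact: measurable_fst].
    apply: measurableT_comp; first exact: mg.
    by apply: measurable_funB; [exact: measurable_snd|exact: measurable_fst].
  by move=> p; rewrite lee_fin mulr_ge0// gamma_kernel_ge0.
rewrite -ge0_integralZl//; last 2 first.
- by apply/measurable_EFinP; apply: mg.
- exact: integral_ge0.
apply: eq_integral => v _.
have [v0|v0] := leP v 0.
  rewrite [gamma_kernel (a + b) v]gamma_kernel_le0// mule0 integral0_eq// => s _.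
  have [s0|s0] := leP s 0; first by rewrite gamma_kernel_le0// mul0r.
  by rewrite [gamma_kernel b _]gamma_kernel_le0 ?mulr0//; lra.
rewrite (integral_affine v 0)//; last 2 first.
- apply/measurable_EFinP; apply: measurable_funM => //.
  apply: measurableT_comp => //; exact: measurable_funB.
- by move=> s; rewrite lee_fin mulr_ge0// gamma_kernel_ge0.
rewrite -ge0_integralZl//; last 3 first.
- apply/measurable_EFinP; apply: measurable_funM => //.
    by apply: measurableT_comp => //; exact: affine_measurable.
  by apply: measurableT_comp => //; apply: measurable_funB => //; apply: affine_measurable.
- by move=> s _; rewrite lee_fin mulr_ge0// gamma_kernel_ge0.
- by rewrite lee_fin ltW.
rewrite -ge0_integralZr//; last first.
  by apply/measurable_EFinP; apply: measurable_beta_kernel.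
by apply: eq_integral => x _; rewrite -!EFinM gamma_kernel_dilation.
Qed.

End EulerIntegrals.

Section EulerIntegralValues.
Local Open Scope classical_set_scope.
Import numFieldNormedType.Exports.
Context {R : realType}.
Notation mu := (@lebesgue_measure R).
Implicit Types (a b c d s t u v x z : R) (n m : nat).

Lemma integral_powR_itvcc z a : 0 < z -> 0 < a < 1 ->
  (\int[mu]_(x in `[a, 1%R]) (x `^ (z - 1))%:E = (z^-1 - z^-1 * a `^ z)%:E)%E.
Proof.
move=> z0 /andP[a0 a1].
have F' x : 0 < x -> is_derive x 1 (fun x => z^-1 * x `^ z) (x `^ (z - 1)).
  move=> x0; have -> : x `^ (z - 1) = z^-1 * (z * x `^ (z - 1)).
    by rewrite mulKf// gt_eqF.
  have h := is_derive1_powR z x0.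
  exact: is_deriveZ.
rewrite (@continuous_FTC2 _ _ (fun x => z^-1 * x `^ z))//.
- by rewrite powR1 mulr1.
- apply: derivable_within_continuous => x; rewrite in_itv/= => /andP[ax _].
  by apply: derivable_powR; rewrite in_itv/= andbT; exact: lt_le_trans ax.
- have dF x : 0 < x -> derivable (fun x => z^-1 * x `^ z) x 1.
    by move=> /F'[].
  have cF x : 0 < x -> {for x, continuous (fun x => z^-1 * x `^ z)}.
    by move=> x0; apply/differentiable_continuous/derivable1_diffP/dF.
  split.
  + by move=> x; rewrite in_itv/= => /andP[ax _]; apply: dF; exact: lt_trans ax.
  + by apply: cvg_at_right_filter; apply: cF.
  + by apply: cvg_at_left_filter; apply: cF.
- move=> x; rewrite in_itv/= => /andP[ax _].
  by rewrite derive1E; apply: derive_val; apply: F'; exact: lt_trans ax.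
Qed.

(** For [z < 1] the integrand is unbounded at [0], so the interval is exhausted
    by the segments [[1 / (n + 2), 1]]. *)
Lemma ebeta_1 z : 0 < z -> ebeta z 1 = z^-1%:E.
Proof.
move=> z0.
have mp D : measurable_fun D (fun x : R => (x `^ (z - 1))%:E).
  by apply/measurable_EFinP; exact: measurable_funTS.
transitivity (\int[mu]_(x in `]0%R, 1%R]) (x `^ (z - 1))%:E)%E.
  rewrite /ebeta -integral_itv_bndo_bndc// [RHS]integral_mkcond.
  apply: eq_integral => x _; rewrite patchE.
  have [|x01] := boolP (x \in `]0, 1[%classic).
    by rewrite inE/= in_itv/= => x01; rewrite beta_kernelE// subrr powRr0 mulr1.
  rewrite beta_kernel_out//; apply: contra x01 => x01.
  by rewrite inE/= in_itv.
pose F n : set (measurableTypeR R) := `[n.+2%:R^-1, 1 : R]%classic.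
have -> : `]0, 1 : R]%classic = \bigcup_n F n.
  apply/seteqP; split => [x|x [n _]]; rewrite /= ?/F/= !in_itv/=; last first.
    move=> /andP[nx x1]; rewrite x1 andbT. by rewrite (lt_le_trans _ nx).
  move=> /andP[x0 x1]; exists (Num.truncn x^-1) => //=; rewrite in_itv/= x1 andbT.
  rewrite -[leRHS]invrK lef_pV2 ?posrE ?invr_gt0//.
  by rewrite (le_trans (ltW (truncnS_gt _)))// ler_nat.
have ndF : nondecreasing_seq F.
  move=> n m nm; rewrite subsetEset => x; rewrite /F/= !in_itv/= => /andP[nx ->].
  by rewrite andbT (le_trans _ nx)// lef_pV2 ?posrE// ler_nat.
have cvgF := @ge0_nondecreasing_set_cvg_integral _ (measurableTypeR R) R F
  (fun x => (x `^ (z - 1))%:E) mu ndF (fun n => measurable_itv _) (fun n => mp _).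
have {}cvgF := cvgF (fun n x _ => powR_ge0 x (z - 1)).
apply: (cvg_unique _ cvgF) => //.
rewrite (_ : (fun i => _) = EFin \o (fun n => z^-1 - z^-1 * n.+2%:R^-1 `^ z)); last first.
  apply/funext => n /=; rewrite /F integral_powR_itvcc//.
  by rewrite invr_gt0 ltr0n/= invf_lt1// ltr1n.
apply: cvg_EFin; first exact: nearW.
rewrite -[X in _ --> X](subr0 z^-1) -[X in _ --> _ - X](mulr0 z^-1).
apply: cvgB; first exact: cvg_cst.
apply: cvgM; first exact: cvg_cst.
have /cvg_at_rightP := @powR_cvg0 R z z0; apply.
by split => //; have := @cvg_harmonic R; rewrite -cvg_shiftS.
Qed.

Lemma egammaE z :
  egamma z = (\int[mu]_(t in `]0%R, +oo[) (t `^ (z - 1) * expR (- t))%:E)%E.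
Proof.
rewrite [RHS]integral_mkcond; apply: eq_integral => t _; rewrite patchE.
have [|t0] := boolP (t \in `]0, +oo[%classic).
  by rewrite inE/= in_itv/= andbT => t0; rewrite gamma_kernelE.
rewrite gamma_kernel_le0// leNgt; apply: contra t0 => t0.
by rewrite inE/= in_itv/= andbT.
Qed.

Lemma egamma_1 : egamma 1 = 1%:E :> \bar R.
Proof.
have me D : measurable_fun D (fun t : R => (expR (- t))%:E).
  by apply/measurable_EFinP; apply: measurable_funTS; exact: measurableT_comp.
rewrite egammaE -(@integral_exponential_pdf R 1 ltr01).
under eq_integral do rewrite subrr powRr0 mul1r.
rewrite integral_itv_obnd_cbnd// integral_mkcond; apply: eq_integral => t _.
by rewrite /exponential_pdf !patchE; case: ifP => // _; rewrite mul1r mulN1r.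
Qed.

Lemma egamma_ge0 z : (0 <= egamma z)%E.
Proof. by apply: integral_ge0 => t _; rewrite lee_fin gamma_kernel_ge0. Qed.

Lemma ebeta_ge0 a b : (0 <= ebeta a b)%E.
Proof. by apply: integral_ge0 => t _; rewrite lee_fin beta_kernel_ge0. Qed.

(** The case [b = 1] of [egamma_mul]. *)
Lemma egammaS z : 0 < z -> egamma (z + 1) = (z%:E * egamma z)%E.
Proof.
move=> z0; rewrite -[in RHS](mule1 (egamma z)) -egamma_1 egamma_mul ebeta_1//.
by rewrite muleA -EFinM mulfV ?mul1e// gt_eqF.
Qed.

Lemma egamma_nat_lty n : (egamma (n.+1%:R : R) < +oo)%E.
Proof.
elim: n => [|n IHn]; first by rewrite egamma_1 ltry.
by rewrite -natr1 egammaS// lte_mul_pinfty ?ge0_fin_numE ?ltry ?lee_fin// egamma_ge0.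
Qed.

(** On [[1, +oo[] the integrand increases with [z], so there an integer
    parameter dominates; on [[0, 1]] the power [t^(z - 1)] does. *)
Lemma egamma_lty z : 0 < z -> (egamma z < +oo)%E.
Proof.
move=> z0; pose n := Num.truncn z.
have mg w : measurable_fun setT (fun t : R => (gamma_kernel w t)%:E).
  by apply/measurable_EFinP; exact: measurable_gamma_kernel.
have mb : measurable_fun setT (fun t : R => (beta_kernel z 1 t)%:E).
  by apply/measurable_EFinP; exact: measurable_beta_kernel.
apply: (@le_lt_trans _ _ (egamma n.+1%:R + ebeta z 1)%E); last first.
  by rewrite lte_add_pinfty// ?egamma_nat_lty// ebeta_1// ltry.
rewrite /egamma /ebeta -ge0_integralD//.
- apply: ge0_le_integral => //.
  + by move=> t _; rewrite lee_fin gamma_kernel_ge0.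
  + exact: mg.
  + by apply: emeasurable_funD; [exact: mg|exact: mb].
  + move=> t _; rewrite -EFinD lee_fin.
    have [t0|t0] := leP t 0.
      by rewrite !gamma_kernel_le0// add0r beta_kernel_ge0.
    have [t1|t1] := ltP t 1.
      rewrite ler_wpDl ?gamma_kernel_ge0// gamma_kernelE// beta_kernelE ?t0//.
      rewrite subrr powRr0 ler_wpM2l ?powR_ge0// -expR0 ler_expR.
      by rewrite lerNl oppr0 ltW.
    rewrite ler_wpDr ?beta_kernel_ge0// !gamma_kernelE// ler_wpM2r ?expR_ge0//.
    by rewrite ler_powR// lerB// ltW// truncnS_gt.
- by move=> t _; rewrite lee_fin gamma_kernel_ge0.
- exact: mg.
- by move=> t _; rewrite lee_fin beta_kernel_ge0.
Qed.

(** The exceptional set [A] allows for the zeros of a polynomial. *)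
Lemma ge0_integral_gt0 (f : R -> R) (A : set R) u v : u < v -> countable A ->
  measurable_fun setT f -> (forall x, 0 <= f x) ->
  (forall x, u < x < v -> ~ A x -> 0 < f x) ->
  (0 < \int[mu]_x (f x)%:E)%E.
Proof.
move=> uv cA mf f0 fA; rewrite lt0e integral_ge0 ?andbT; last first.
  by move=> x _; rewrite lee_fin.
apply/eqP => int0.
have mEf : measurable_fun setT (EFin \o f) by exact/measurable_EFinP.
have : (\int[mu]_x `|(EFin \o f) x| = 0)%E.
  by rewrite -[RHS]int0; apply: eq_integral => x _ /=; rewrite ger0_norm.
move/(ae_eq_integral_abs mu measurableT mEf) => [N [mN N0 fN]].
have mA : measurable A by apply: countable_measurable => // x; exact: measurable_set1.
have uvNA : `]u, v[ `<=` N `|` A.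
  move=> x /=; rewrite in_itv/= => uxv; have [Ax|nAx] := pselect (A x); [by right|left].
  by apply: fN => /= /(_ Logic.I) [fx0]; have := fA x uxv nAx; rewrite fx0 ltxx.
have : (mu `]u, v[%classic <= 0)%E.
  apply: (@le_trans _ _ (mu (N `|` A))).
    by apply: le_measure => //; rewrite inE//; exact: measurableU.
  have <- : (mu N + mu A = 0)%E by rewrite N0 countable_lebesgue_measure0// adde0.
  exact: measureU2.
by rewrite lebesgue_measure_itv/= lte_fin uv -EFinB lee_fin leNgt subr_gt0 uv.
Qed.

Lemma egamma_gt0 z : (0 < egamma z)%E.
Proof.
apply: (@ge0_integral_gt0 _ set0 0 1) => //.
- exact: measurable_gamma_kernel.
- exact: gamma_kernel_ge0.
- by move=> t /andP[t0 _] _; rewrite gamma_kernelE// mulr_gt0 ?powR_gt0 ?expR_gt0.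
Qed.

Lemma GammaE z : 0 < z -> (Gamma z)%:E = egamma z.
Proof.
move=> z0; rewrite /Gamma /Rintegral -egammaE fineK//.
by rewrite ge0_fin_numE ?egamma_ge0// egamma_lty.
Qed.

Lemma Gamma_gt0 z : 0 < z -> 0 < Gamma z.
Proof. by move=> z0; rewrite -lte_fin GammaE// egamma_gt0. Qed.

Lemma Gamma_pochhammer z n : 0 < z -> Gamma (z + n%:R) = Gamma z * pochhammer z n.
Proof.
move=> z0; elim: n => [|n IHn]; first by rewrite /pochhammer big_ord0 addr0 mulr1.
rewrite /pochhammer big_ord_recr/= mulrA -IHn -natr1 addrA.
have zn : 0 < z + n%:R by rewrite ltr_wpDr.
by apply: EFin_inj; rewrite EFinM !GammaE// ?egammaS 1?muleC// (addr_gt0 zn).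
Qed.

Lemma ebetaE a b : 0 < a -> 0 < b ->
  ebeta a b = (Gamma a * Gamma b / Gamma (a + b))%:E.
Proof.
move=> a0 b0; have ab := addr_gt0 a0 b0; have Gab := Gamma_gt0 _ ab.
have := egamma_mul a b; rewrite -!GammaE// -EFinM.
case: (ebeta a b) (ebeta_ge0 a b) => [r _| _|//].
  by rewrite -EFinM => -[->]; rewrite mulfK// gt_eqF.
by rewrite gt0_mulye ?lte_fin.
Qed.
End EulerIntegralValues.

(** * The Jacobi inner product *)

Section JacobiInner.
Local Open Scope classical_set_scope.
Context {R : realType}.
Notation mu := (@lebesgue_measure R).
Implicit Types (a b c x : R) (f g : {poly R}) (n m p q : nat).

Lemma measurable_horner f D : measurable_fun D (fun x : R => f.[x]).
Proof.
apply: measurable_funTS; apply: continuous_measurable_fun.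
exact: continuous_horner.
Qed.

(** A polynomial is bounded on [[0, 1]] by the sum of the absolute values of
    its coefficients. *)
Lemma beta_kernel_integrable a b f : 0 < a -> 0 < b ->
  mu.-integrable setT (fun x => (beta_kernel a b x * f.[x])%:E).
Proof.
move=> a0 b0; have mb := measurable_beta_kernel a b.
pose M := \sum_(i < size f) `|f`_i|.
have fM x : 0 < x < 1 -> `|f.[x]| <= M.
  move=> /andP[x0 x1]; rewrite horner_coef (le_trans (ler_norm_sum _ _ _))//.
  apply: ler_sum => i _; rewrite normrM normrX (gtr0_norm x0) ler_piMr//.
  by rewrite exprn_ile1// ltW.
have ib : mu.-integrable setT (EFin \o beta_kernel a b).
  apply/integrableP; split; first by apply/measurable_EFinP; exact: mb.
  under eq_integral do rewrite /= ger0_norm ?beta_kernel_ge0//.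
  by rewrite -/(ebeta a b) ebetaE// ltry.
apply: (le_integrable measurableT _ _ (integrableZl measurableT M ib)).
  apply/measurable_EFinP; apply: measurable_funM; first exact: mb.
  exact: measurable_horner.
move=> x _ /=; rewrite lee_fin normrM [leRHS]normrM mulrC.
have [x01|x01] := boolP (0 < x < 1); last by rewrite beta_kernel_out// normr0 !mulr0.
by rewrite ler_wpM2r// (le_trans (fM x x01))// ler_norm.
Qed.

Definition beta_integral a b f : R := (\int[mu]_x (beta_kernel a b x * f.[x]))%R.

Lemma jacobi_innerE (alpha beta : R) f g :
  jacobi_inner alpha beta f g = beta_integral (beta + 1) (alpha + 1) (f * g).
Proof.
have mw D : measurable_fun D
    (fun x : R => (1 - x) `^ alpha * x `^ beta * f.[x] * g.[x]).
  apply: measurable_funM; last exact: measurable_horner.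
  apply: measurable_funM; last exact: measurable_horner.
  apply: measurable_funTS; apply: measurable_funM => //.
  apply: (@measurableT_comp _ _ _ _ _ _ (fun x => x `^ alpha)) => //.
  exact: measurable_funB.
rewrite /jacobi_inner /beta_integral /Rintegral; congr fine.
rewrite integral_itv_bndoo; last exact/measurable_EFinP.
rewrite [LHS]integral_mkcond; apply: eq_integral => x _; rewrite patchE.
have [|x01] := boolP (x \in `]0, 1[%classic).
  rewrite inE/= in_itv/= => x01; rewrite beta_kernelE// !addrK hornerM; congr EFin.
  by ring.
rewrite beta_kernel_out ?mul0r//; apply: contra x01 => x01.
by rewrite inE/= in_itv.
Qed.

Lemma beta_integral_scalar a b : 0 < a -> 0 < b -> scalar (beta_integral a b).
Proof.
move=> a0 b0 c f g; have ib f := beta_kernel_integrable a b f a0 b0.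
rewrite /beta_integral -RintegralZl//; last exact: ib.
rewrite -RintegralD//; last 2 first.
- by have := integrableZl measurableT c (ib f).
- exact: ib.
apply: eq_Rintegral => x _; rewrite hornerD hornerZ; ring.
Qed.

(** Monomials only shift the exponents of the weight. *)
Lemma beta_integral_monomial a b p q : 0 < a -> 0 < b ->
  beta_integral a b ('X^q * (1 - 'X) ^+ p) =
  Gamma b * Gamma a / Gamma (b + a) *
  (pochhammer b p * pochhammer a q / pochhammer (b + a) (p + q)).
Proof.
move=> a0 b0; have aq : 0 < a + q%:R by rewrite ltr_wpDr.
have bp : 0 < b + p%:R by rewrite ltr_wpDr.
transitivity (fine (ebeta (a + q%:R) (b + p%:R))).
  congr fine; apply: eq_integral => x _; congr EFin.
  have [x01|x01] := boolP (0 < x < 1); last by rewrite !beta_kernel_out ?mul0r.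
  have /andP[x0 x1] := x01; have x1' : 0 < 1 - x by rewrite subr_gt0.
  rewrite !beta_kernelE// hornerM hornerXn horner_exp horner_onem.
  rewrite !(addrAC _ _%:R) !powRD ?(gt_eqF x0) ?(gt_eqF x1') ?implybT//.
  by rewrite !powR_mulrn ?ltW//; ring.
rewrite ebetaE//= !Gamma_pochhammer//.
have -> : a + q%:R + (b + p%:R) = b + a + (p + q)%:R by rewrite natrD; ring.
rewrite Gamma_pochhammer ?addr_gt0//.
have := pochhammer_gt0 (b + a) (p + q) (addr_gt0 b0 a0).
have := Gamma_gt0 (b + a) (addr_gt0 b0 a0).
by move=> G0 P0; field; rewrite !gt_eqF.
Qed.

(** A nonzero polynomial has finitely many roots. *)
Lemma beta_integral_definite a b : 0 < a -> 0 < b -> definite (beta_integral a b).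
Proof.
move=> a0 b0 f f0 intf; apply/eqP/negPn/negP => fn0.
have : (0 < \int[mu]_x (beta_kernel a b x * f.[x])%:E)%E.
  apply: (@ge0_integral_gt0 _ _ [set x | root f x] 0 1) => //.
  - apply: finite_set_countable; apply: contrapT => /(infinite_set_fset (size f))[B Bf].
    apply/negP; rewrite -ltnNge; apply: max_poly_roots => //.
      by apply/allP => x xB; exact: Bf.
    exact: finmap.fset_uniq.
  - apply: measurable_funM; first exact: measurable_beta_kernel.
    exact: measurable_horner.
  - move=> x; have [x01|x01] := boolP (0 < x < 1); last by rewrite beta_kernel_out ?mul0r.
    by rewrite mulr_ge0 ?beta_kernel_ge0 ?f0.
  - move=> x x01 /negP fx; have /andP[x0 x1] := x01.
    rewrite mulr_gt0// ?beta_kernelE ?mulr_gt0 ?powR_gt0 ?subr_gt0//.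
    by rewrite lt_neqAle eq_sym f0// andbT.
rewrite -(@fineK _ (\int[mu]_x _)); last first.
  exact: (integrable_fin_num _ (beta_kernel_integrable a b f a0 b0)).
by rewrite -/(beta_integral a b f) [fine _]intf ltxx.
Qed.

Lemma jacobi_inner_beta (alpha beta : R) : -1 < alpha -> -1 < beta ->
  beta_functional alpha beta (Kconst alpha beta) (beta_integral (beta + 1) (alpha + 1)).
Proof.
move=> halpha hbeta; have a0 : 0 < alpha + 1 by lra.
have b0 : 0 < beta + 1 by lra.
split; first exact: beta_integral_scalar.
move=> p q; rewrite beta_integral_monomial// /Kconst /sigma.
have -> : alpha + 1 + (beta + 1) = alpha + beta + 2 by ring.
by have -> : alpha + beta + 1 + 1 = alpha + beta + 2 by ring.
Qed.

End JacobiInner.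

Theorem theorem2p1 (R : realType) (alpha beta : R)
    (halpha : -1 < alpha) (hbeta : -1 < beta) (n : nat)
    (D : nat -> {poly R}) (hD : is_dual_bernstein alpha beta n D)
    (i : nat) (hi : (i <= n)%N) :
  (i%:R + 1) *: (('X - 1) * D i) + (n%:R - i%:R) *: ('X * D i.+1) =
  (- Cconst alpha beta n i.+1 / ((2 * n)%:R + sigma alpha beta + 2)) *:
    Tpoly alpha beta n i.
Proof.
have [sizeD dualD _] := hD.
have a0 : 0 < alpha + 1 by lra.
have b0 : 0 < beta + 1 by lra.
have s0 : 0 < alpha + beta + 2 by lra.
have K0 : Kconst alpha beta != 0.
  rewrite /Kconst /sigma (_ : _ + 1 + 1 = alpha + beta + 2); last by ring.
  by rewrite gt_eqF// divr_gt0 ?mulr_gt0 ?Gamma_gt0.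
rewrite (@dual_bernstein_identity _ _ _ _ _ _ _ halpha hbeta K0
  (jacobi_inner_beta _ _ halpha hbeta))//.
- congr (_ *: _); rewrite /Cconst addn1 subSS /sigma.
  rewrite (_ : alpha + beta + 1 + 1 = alpha + beta + 2); last by ring.
  have n0 : 0 < 2 * n%:R + (alpha + beta + 1) + 2 :> R.
    by rewrite -addrA ltr_wpDl ?mulr_ge0//; lra.
  by field; rewrite K0 !gt_eqF ?pochhammer_gt0.
- exact: beta_integral_definite.
- by move=> k j kn jn; rewrite -jacobi_innerE dualD.
Qed.
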